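(* Let $Z$ and $Y$ be real Hilbert spaces, let $X\subset Z$, and let $v\colon X\to Y$ be a map. The following are equivalent: (E) for every $A\subset X$, every $\rho\geq 0$, and every $1$-Lipschitz map $u\colon A\to Y$ satisfying $\|u(x)-v(x)\|\leq\rho$ for all $x\in A$, there is a $1$-Lipschitz map $\widetilde u\colon X\to Y$ with $\widetilde u|_A=u$ and $\|\widetilde u(x)-v(x)\|\leq\rho$ for all $x\in X$; (C) for every positive integer $k\leq\dim Y$, one has $$\Big\|v(x_0)-\sum_{i=1}^{k}t_i v(x_i)\Big\|\leq\Big\|x_0-\sum_{i=1}^{k}t_i x_i\Big\|$$ for all $x_0,x_1,\ldots,x_k\in X$ and all $t_1,\ldots,t_k\geq 0$ with $\sum_{i=1}^k t_i=1$.
   Context: A map between subsets of Hilbert spaces is $1$-Lipschitz if it does not increase norm distances. If $Y$ is infinite-dimensional, the restriction $k\leq\dim Y$ is vacuous, i.e. (C) is required for every positive integer $k$. *)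

(* Defs.v *)
From HB Require Import structures.
From mathcomp Require Import all_boot all_order all_algebra.
From mathcomp Require Import all_classical all_reals all_analysis.
Set Implicit Arguments.
Unset Strict Implicit.
Unset Printing Implicit Defensive.
Import Order.TTheory GRing.Theory Num.Theory.
Import numFieldNormedType.Exports.
Local Open Scope classical_set_scope.
Local Open Scope ring_scope.

(* [{dot H for idfun}] is the type of symmetric positive definite bilinear
   forms; completeness is carried by [completeNormedModType]. *)
Definition hilbert (R : realType) (H : completeNormedModType R) : Prop :=
  exists dot : {dot H for (@idfun R)}, forall x : H, `|x| ^+ 2 = dot x x.

Definition lin_indep (R : realType) (V : lmodType R) (k : nat)
    (e : 'I_k -> V) : Prop :=
  forall a : 'I_k -> R, \sum_(i < k) a i *: e i = 0 -> forall i, a i = 0.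

(* Equal to [+oo] exactly when there are arbitrarily large finite linearly
   independent families. *)
Definition lin_dim (R : realType) (V : lmodType R) : \bar R :=
  ereal_sup [set (k%:R)%:E | k in
    [set k : nat | exists e : 'I_k -> V, lin_indep e]].
Arguments lin_dim {R} V.

(* Main.v *)
(** From (C) to (E), Zorn's lemma and the finite intersection property of
balls reduce the claim to adding one point [x0], given finitely many pairs
[(a_i, b_i)].  Maximizing the dual
[t |-> sum_i t_i (|p_i|^2 - r_i^2) - |sum_i t_i p_i|^2] over the simplex, with
[p_0 = v x0], [r_0 = rho], [p_i = b_i], [r_i = |x0 - a_i|], yields
[m = sum_i t_i p_i] with [|m - p_i|^2 <= r_i^2 + M], with equality when
[t_i > 0]; Caratheodory makes the active [p_i] affinely independent.  Suppose
[M > 0].  Let [b], [a], [v'] be the averages of the [b_i], [a_i], [v a_i] with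
the renormalized weights [t_i], [i > 0].  Comparing variances gives
[t_0 |b - v x0| > |a - x0|], and [(1 - t_0) |b - v x0| > rho] since [p_0] is
active, so [|b - v x0| > rho + |a - x0|].  But [|b - v'| <= rho], and (C) gives
[|v' - v x0| <= |a - x0|]: at most [dim Y] points [a_i] are involved, as the
vectors [b_i - v x0] are linearly independent.

From (E) to (C), let [e] be the direction of [sum_i t_i v x_i - v x0] and
[f z = <v z, e>].  If (C) fails then, after changing the weights, [f] agrees on
the active [x_i] with an affine function of slope [p], [|p| <= 1], while still
[f x0 + |x0 - sum_i s_i x_i| < sum_i s_i f x_i].  The form
[<x, y> - <x, p><y, p>] is positive, so on differences of the active points it
is the pullback of the inner product by some [W] with values in the orthogonal
complement of [e], where [k - 1] dimensions suffice.  Hence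
[u z = v x0 + (rho - eta + f z - f x0) e + W (z - x_j)] is isometric on the
active points, and for [rho] large it is within [rho] of [v]; but any
admissible value at [x0] would have [e]-component larger than that of [v x0] by
more than [rho]. *)
Require Import Defs.
From HB Require Import structures.
From mathcomp Require Import all_boot all_order all_algebra.
From mathcomp Require Import all_classical all_reals all_analysis.
From mathcomp Require Import ring lra.
Import Order.TTheory GRing.Theory Num.Theory.
Import numFieldNormedType.Exports.
Local Open Scope classical_set_scope.
Local Open Scope ring_scope.
Set Implicit Arguments.
Unset Strict Implicit.
Unset Printing Implicit Defensive.

(** * Positive semidefinite forms *)

(** Definiteness is left out because degenerate forms occur below: [BZ x y - BZ p x * BZ p y] with
    [BZ p p <= 1], and Schur complements. *)
Record psd {R : realType} {V : lmodType R} (B : V -> V -> R) : Prop := Psd {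
  psdC : forall x y, B x y = B y x;
  psdP : forall a x y z, B (a *: x + y) z = a * B x z + B y z;
  psd_ge0 : forall x, 0 <= B x x }.

Section PsdTheory.
Context {R : realType} {V : lmodType R} {B : V -> V -> R} (hB : psd B).

Lemma psdDl x y z : B (x + y) z = B x z + B y z.
Proof. by rewrite -{1}[x]scale1r psdP// mul1r. Qed.

Lemma psd0l z : B 0 z = 0.
Proof. by have := psdDl 0 0 z; rewrite addr0; lra. Qed.

Lemma psdZl a x z : B (a *: x) z = a * B x z.
Proof. by rewrite -[a *: x]addr0 psdP// psd0l addr0. Qed.

Lemma psdNl x z : B (- x) z = - B x z.
Proof. by rewrite -scaleN1r psdZl mulN1r. Qed.

Lemma psdDr x y z : B z (x + y) = B z x + B z y.
Proof. by rewrite !(psdC hB z) psdDl. Qed.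

Lemma psdZr a x z : B z (a *: x) = a * B z x.
Proof. by rewrite !(psdC hB z) psdZl. Qed.

Lemma psdNr x z : B z (- x) = - B z x.
Proof. by rewrite !(psdC hB z) psdNl. Qed.

Lemma psd0r z : B z 0 = 0.
Proof. by rewrite psdC// psd0l. Qed.

Definition psdE := (psdDl, psdDr, psdZl, psdZr, psdNl, psdNr, psd0l, psd0r).

Lemma psd_suml (I : Type) (r : seq I) (P : pred I) (F : I -> V) z :
  B (\sum_(i <- r | P i) F i) z = \sum_(i <- r | P i) B (F i) z.
Proof.
by apply: (big_morph (B ^~ z)) => [x y|]; rewrite ?psdDl ?psd0l.
Qed.

Lemma psd_sumr (I : Type) (r : seq I) (P : pred I) (F : I -> V) z :
  B z (\sum_(i <- r | P i) F i) = \sum_(i <- r | P i) B z (F i).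
Proof. by rewrite psdC// psd_suml; apply: eq_bigr => i _; rewrite psdC. Qed.

Lemma psdCS x y : B x y ^+ 2 <= B x x * B y y.
Proof.
have q a : 0 <= B x x - 2 * a * B x y + a ^+ 2 * B y y.
  have := psd_ge0 hB (x - a *: y); rewrite !psdE (psdC hB y x).
  by congr (_ <= _); ring.
have [y0|y0] := eqVneq (B y y) 0.
  have [->|xy0] := eqVneq (B x y) 0; first by rewrite expr0n/= y0 mulr0.
  (* With [B y y = 0] the quadratic is affine in [a], and this [a] gives it the value -1. *)
  have := q ((B x x + 1) / (2 * B x y)).
  rewrite y0 mulr0 addr0 (_ : 2 * _ * _ = B x x + 1); last by field.
  lra.
have yp : 0 < B y y by rewrite lt_neqAle eq_sym y0 psd_ge0.
have := q (B x y / B y y).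
rewrite (_ : _ + _ = (B x x * B y y - B x y ^+ 2) / B y y); last by field.
by rewrite pmulr_lge0 ?invr_gt0// subr_ge0.
Qed.

Lemma psd_eq0 x y : B x x = 0 -> B x y = 0.
Proof.
move=> x0; have := psdCS x y; rewrite x0 mul0r => h; apply/eqP.
by rewrite -sqrf_eq0 eq_le h sqr_ge0.
Qed.

(** Parallel axis identity: as a function of [c], the left side is a quadratic whose linear term
    involves the [p i] only through [m]. *)
Lemma psd_variance (I : finType) (t : I -> R) (p : I -> V) c :
  let m := \sum_i t i *: p i in
  \sum_i t i = 1 ->
  \sum_i t i * B (p i - c) (p i - c) =
  B (m - c) (m - c) + \sum_i t i * B (p i - m) (p i - m).
Proof.
move=> m t1.
have e d : \sum_i t i * B (p i - d) (p i - d) =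
   \sum_i t i * B (p i) (p i) - 2 * B m d + B d d.
  rewrite (eq_bigr (fun i => t i * B (p i) (p i) - 2 * B (t i *: p i) d + t i * B d d)); last first.
    by move=> i _; rewrite !psdE (psdC hB d); ring.
  by rewrite !big_split/= -mulr_suml t1 mul1r sumrN -mulr_sumr -psd_suml.
by rewrite !e !psdE (psdC hB c); ring.
Qed.

(** Averaging [psd_variance] over [c = p j] turns its first term into a second copy of the variance.
    Bounds on pairwise distances thus control the variance. *)
Lemma psd_variance_pairs (I : finType) (t : I -> R) (p : I -> V) :
  let m := \sum_i t i *: p i in
  \sum_i t i = 1 ->
  \sum_j t j * \sum_i t i * B (p i - p j) (p i - p j) =
  2 * \sum_i t i * B (p i - m) (p i - m).
Proof.
move=> m t1; under eq_bigr do rewrite psd_variance//.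
rewrite -/m; under eq_bigr do rewrite mulrDr.
rewrite big_split/= -[X in _ + X]mulr_suml t1 mul1r.
rewrite [X in X + _](eq_bigr (fun i => t i * B (p i - m) (p i - m))) ?[RHS]mulr_natl//.
by move=> i _; rewrite -opprB psdNl psdNr opprK.
Qed.

End PsdTheory.
Arguments psdE {R V B}.

Definition inner {R : realType} {H : normedModType R} (B : H -> H -> R) : Prop :=
  psd B /\ forall x, `|x| ^+ 2 = B x x.

Lemma hilbert_inner (R : realType) (H : completeNormedModType R) :
  hilbert H -> exists B : H -> H -> R, inner B.
Proof.
move=> [dot hd]; exists dot; split => //; split.
- by move=> x y; rewrite hermC/= expr0 mul1r.
- by move=> a x y z; rewrite linearPl.
- by move=> x; rewrite -hd sqr_ge0.
Qed.

(** * Concave maximization over the simplex *)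

Definition simplex {R : realType} {I : finType} (t : I -> R) : Prop :=
  (forall i, 0 <= t i) /\ \sum_i t i = 1.

Lemma continuous_sum (R : realType) (T : topologicalType) (V : normedModType R)
    (I : finType) (F : I -> T -> V) :
  (forall i, continuous (F i)) -> continuous (fun x => \sum_i F i x).
Proof. by move=> Fc; apply: continuous_big => // ; exact: add_continuous. Qed.

(** Row vectors carry the topology: there the simplex is a closed part of the compact unit cube. *)
Lemma simplex_max (R : realType) n (phi : ('I_n.+1 -> R) -> R) :
  continuous (fun v : 'rV[R]_n.+1 => phi (v ord0)) ->
  exists2 t, simplex t & forall s, simplex s -> phi s <= phi t.
Proof.
move=> phic.
pose A := [set v : 'rV[R]_n.+1 | forall i, `[0, 1]%classic (v ord0 i)] `&`
          (fun v : 'rV[R]_n.+1 => \sum_i v ord0 i) @^-1` [set 1].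
have AE (s : 'I_n.+1 -> R) : simplex s -> A (\row_i s i).
  move=> [s0 s1]; split => /=.
    move=> i; rewrite /= mxE in_itv/= s0/= -s1 (bigD1 i)//= lerDl.
    exact: sumr_ge0.
  by rewrite -[RHS]s1; apply: eq_bigr => i _; rewrite mxE.
have cA : compact A.
  apply: compact_closedI.
    exact: (@rV_compact R n.+1 (fun=> `[(0 : R), 1]%classic) (fun=> @segment_compact R 0 1)).
  apply: closed_comp; last exact: closed_eq.
  move=> v _; move: v; apply: continuous_sum => i; exact: coord_continuous.
have A0 : A !=set0.
  exists (\row_i (i == ord0)%:R); apply: AE; split=> [i|]; first exact: ler0n.
  by rewrite (bigD1 ord0)//= big1 ?addr0// => i /negPf ->.
have [c + cmax] := EVT_max_rV A0 cA (continuous_subspaceT phic).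
rewrite inE => -[/= c01 c1]; exists (c ord0).
  by split=> // i; have := c01 i; rewrite /= in_itv/= => /andP[].
move=> s /AE As; have := cmax _ (mem_set As).
by congr (phi _ <= _); apply/funext => i; rewrite mxE.
Qed.

Lemma le0_small_multiples (R : realFieldType) (a b : R) :
  (forall l, 0 < l <= 1 -> a <= l * b) -> a <= 0.
Proof.
move=> h; rewrite leNgt; apply/negP => a0.
have p : 0 < a + `|b| by rewrite ltr_wpDr.
have := h (a / (a + `|b|)); rewrite divr_gt0//= ler_pdivrMr// mul1r lerDl.
move=> /(_ (normr_ge0 _)); rewrite mulrAC ler_pdivlMr// ler_pM2l//.
by have := ler_norm b; lra.
Qed.

(** Karush-Kuhn-Tucker conditions. Since [g] bounds the growth of [h] up to a quadratic error,
    moving from the maximizer towards a vertex cannot have positive first-order gain. *)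
Lemma simplex_opt (R : realType) (H : normedModType R) (B : H -> H -> R) n
    (c : 'I_n.+1 -> R) (z : 'I_n.+1 -> H) (h : H -> R) (g : H -> H) (K : R) :
  inner B -> continuous h ->
  (forall x d, h (x + d) <= h x + B (g x) d + K * B d d) ->
  exists t, let m := \sum_i t i *: z i in
  [/\ simplex t,
      forall s, simplex s ->
        \sum_i s i * c i - h (\sum_i s i *: z i) <= \sum_i t i * c i - h m,
      forall i, c i - B (g m) (z i - m) <= \sum_i t i * c i &
      forall i, 0 < t i -> c i - B (g m) (z i - m) = \sum_i t i * c i].
Proof.
move=> [hB _] hc hg.
have [|t st tmax] := @simplex_max R n (fun s => \sum_i s i * c i - h (\sum_i s i *: z i)).
  have c1 : continuous (fun v : 'rV[R]_n.+1 => \sum_i v ord0 i * c i).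
    apply: (@continuous_sum R _ R^o) => i v.
    exact: cvgMr_tmp (@coord_continuous R 1 n.+1 ord0 i v).
  have c2 : continuous (fun v : 'rV[R]_n.+1 => \sum_i v ord0 i *: z i).
    apply: continuous_sum => i v.
    exact: cvgZr_tmp (@coord_continuous R 1 n.+1 ord0 i v).
  move=> v; exact: cvgB (c1 v) (continuous_comp (c2 v) (hc _)).
exists t => m.
have le i : c i - B (g m) (z i - m) <= \sum_i t i * c i.
  rewrite -subr_le0; apply: (@le0_small_multiples _ _ (K * B (z i - m) (z i - m))).
  move=> l /andP[l0 l1].
  (* Move a fraction [l] of the way from [t] to the vertex [i]. *)
  pose s j := (1 - l) * t j + l * (j == i)%:R.
  have sum_s (V : lmodType R) (F : 'I_n.+1 -> V) :
      \sum_j s j *: F j = \sum_j t j *: F j + l *: (F i - \sum_j t j *: F j).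
    under eq_bigr do rewrite /s scalerDl -!scalerA.
    rewrite big_split/= -!scaler_sumr.
    have -> : \sum_j (j == i)%:R *: F j = F i.
      rewrite (bigD1 i)//= eqxx scale1r big1 ?addr0// => j /negPf ->.
      by rewrite scale0r.
    by rewrite scalerBl scalerBr scale1r addrAC addrA.
  have ss : simplex s.
    split=> [j|].
      by rewrite addr_ge0// mulr_ge0 ?ler0n ?subr_ge0 ?(ltW l0)//; case: st.
    have := sum_s _ (fun=> 1 : R^o).
    under eq_bigr do rewrite [_ *: _]mulr1.
    under [in RHS]eq_bigr do rewrite [_ *: _]mulr1.
    by rewrite st.2 subrr scaler0 addr0.
  have := tmax _ ss; rewrite (sum_s H z) -/m.
  have -> : \sum_i s i * c i = \sum_i t i * c i + l * (c i - \sum_i t i * c i).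
    exact: (sum_s R^o c).
  have := hg m (l *: (z i - m)); rewrite !(psdZl hB, psdZr hB).
  set X := B _ _; set Y := B _ _; move=> h1 h2.
  have : l * (c i - \sum_i t i * c i - X) <= l * (l * (K * Y)) by nra.
  by rewrite ler_pM2l// => h3; lra.
split=> // i ti.
(* Complementary slackness: the slacks weighted by [t] are nonnegative and sum to zero, because
   [\sum_j t j *: (z j - m) = 0]. *)
pose e j := t j * (\sum_i t i * c i - (c j - B (g m) (z j - m))).
have e0 : \sum_j e j = 0.
  rewrite /e; under eq_bigr do rewrite mulrBr.
  rewrite sumrB -mulr_suml st.2 mul1r.
  under [X in _ - X]eq_bigr do rewrite mulrBr (psdC hB) -(psdZl hB) scalerBr.
  rewrite sumrB -(psd_suml hB) sumrB -scaler_suml st.2 scale1r subrr (psd0l hB).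
  by rewrite subr0 subrr.
have /psumr_eq0P : forall j, true -> 0 <= e j by move=> j _; rewrite mulr_ge0 ?st.1 ?subr_ge0.
by move=> /(_ e0 i isT)/eqP; rewrite mulf_eq0 gt_eqF//= subr_eq0 => /eqP.
Qed.

(** * Intersection of balls in a Hilbert space *)

Lemma balls_intersect (R : realType) (H : completeNormedModType R)
    (B : H -> H -> R) (S : set (H * R)) (q : H) (r : R) :
  inner B -> S (q, r) ->
  (forall s : seq (H * R), (forall b, b \in s -> S b) ->
     exists y, forall b, b \in s -> `|y - b.1| <= b.2) ->
  exists y, forall b, S b -> `|y - b.1| <= b.2.
Proof.
(* Near-minimizers of the distance to [q] over the finite subintersections
   form a Cauchy filter, by the parallelogram identity. *)
move=> [hB nB] Sq fip.
pose good (s : seq (H * R)) := forall b, b \in s -> S b.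
pose C (s : seq (H * R)) y := forall b, b \in s -> `|y - b.1| <= b.2.
have good_cat s1 s2 : good s1 -> good s2 -> good (s1 ++ s2).
  by move=> g1 g2 b; rewrite mem_cat => /orP[/g1|/g2].
have C_cat s1 s2 y : C (s1 ++ s2) y -> C s1 y /\ C s2 y.
  by move=> c; split=> b bs; apply: c; rewrite mem_cat bs ?orbT.
(* [sup E] is the supremum of the distances from [q] to the finite subintersections. Adjoining the
   ball [(q, r)] to a list shows that it is at most [r]. *)
pose E := [set d | exists s, good s /\ forall y, C s y -> d <= `|y - q|].
have E0 : E 0 by exists [::]; split=> // y _; exact: normr_ge0.
have Er : ubound E r.
  move=> d [s [gs hs]].
  have [|y cy] := fip ((q, r) :: s).
    by move=> b; rewrite inE => /predU1P[->|/gs].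
  apply: le_trans (hs y _) (cy (q, r) _); last exact: mem_head.
  by move=> b bs; apply: cy; rewrite inE bs orbT.
have supE : has_sup E by split; [exists 0|exists r].
pose D := sup E.
have D0 : 0 <= D by apply: ub_le_sup => //; exists r.
have far e : 0 < e -> exists2 s, good s & forall y, C s y -> D - e < `|y - q|.
  move=> e0; have [d [s [gs hs]] dD] := sup_adherent e0 supE.
  by exists s => // y /hs; apply: lt_le_trans.
have near_ e s : 0 < e -> good s -> exists2 y, C s y & `|y - q| < D + e.
  move=> e0 gs; apply: contrapT => hn.
  have : E (D + e).
    exists s; split=> // y cy; rewrite leNgt; apply/negP => yq.
    by apply: hn; exists y.
  by move=> /(ub_le_sup (ex_intro _ r Er)); rewrite -/D; lra.
pose K (p : seq (H * R) * R) := [set y | C p.1 y /\ `|y - q| < D + p.2].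
pose P := [set p : seq (H * R) * R | good p.1 /\ 0 < p.2].
pose F := filter_from P K.
have FF : ProperFilter F.
  apply: filter_from_proper; last first.
    by move=> [s e] [/= gs e0]; have [y cy yq] := near_ e s e0 gs; exists y.
  apply: filter_from_filter; first by exists ([::], 1); split.
  move=> [s1 e1] [s2 e2] [/= g1 p1] [/= g2 p2].
  exists (s1 ++ s2, Num.min e1 e2).
    by split; [exact: good_cat|rewrite lt_min p1 p2].
  by move=> y [/= /C_cat[c1 c2]]; rewrite -ltrBlDl lt_min !ltrBlDl => /andP[].
have Fcauchy : cauchy F.
  apply: cauchy_exP => e /= e0.
  (* The parallelogram identity will give [4 (D + d)^2 - 4 (D - d)^2 = 16 D d < e^2]. If [D < d],
     the term in [a] is dropped and [4 (D + d)^2 < 16 d^2 < 16 d < e^2], as [d < 1]. *)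
  pose d := e ^+ 2 / (16 * (D + 1 + e ^+ 2)).
  have e20 : 0 < e ^+ 2 by rewrite exprn_gt0.
  have den : 0 < 16 * (D + 1 + e ^+ 2) by lra.
  have d0 : 0 < d by rewrite divr_gt0.
  have dE : d * (16 * (D + 1 + e ^+ 2)) = e ^+ 2 by rewrite /d divfK// gt_eqF.
  have d1 : d < 1 by rewrite /d ltr_pdivrMr//; lra.
  have [s gs hs] := far d d0.
  have [y0 c0 q0] := near_ d s d0 gs.
  exists y0; exists (s, d); first by split.
  move=> y [/= cy yq]; rewrite -ball_normE/=.
  rewrite -(@ltr_pXn2r _ 2)// ?nnegrE ?(ltW e0)//.
  (* Balls are convex, so the midpoint stays in the subintersection and is also far from [q]. *)
  have /hs : C s (2^-1 *: (y + y0)).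
    move=> b bs; have := cy b bs; have := c0 b bs.
    rewrite (_ : 2^-1 *: (y + y0) - b.1 = 2^-1 *: ((y - b.1) + (y0 - b.1))); last first.
      by rewrite addrACA -opprD scalerBr -mulr2n -[b.1 *+ 2]scaler_nat scalerA mulVf// scale1r.
    rewrite normrZ ger0_norm ?invr_ge0// => h1 h2.
    by have := ler_normD (y - b.1) (y0 - b.1); lra.
  set w := _ *: _ => hw.
  have par : `|y0 - y| ^+ 2 = 2 * `|y - q| ^+ 2 + 2 * `|y0 - q| ^+ 2 - 4 * `|w - q| ^+ 2.
    by rewrite !nB /w !(psdE hB) !(psdC hB q) (psdC hB y0 y); field.
  have := normr_ge0 (w - q); have := normr_ge0 (y - q); have := normr_ge0 (y0 - q).
  rewrite par; move: hw yq q0.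
  move: `|w - q| `|y - q| `|y0 - q| => a b c ha hb hc c0' b0 a0.
  have b2 : b ^+ 2 <= (D + d) ^+ 2 by rewrite ler_pXn2r ?nnegrE//; lra.
  have c2 : c ^+ 2 <= (D + d) ^+ 2 by rewrite ler_pXn2r ?nnegrE//; lra.
  have de := mulr_gt0 d0 e20.
  have [dD|dD] := leP d D.
    have : (D - d) ^+ 2 <= a ^+ 2 by rewrite ler_pXn2r ?nnegrE//; lra.
    by nra.
  by have := sqr_ge0 a; nra.
have /cvg_ex[y Fy] : cvg F by apply: cauchy_cvg.
exists y => b Sb; apply/ler_addgt0Pr => e e0.
have F1 : F (ball y e) by apply: Fy; exact: nbhsx_ballx.
have F2 : F (K ([:: b], 1)).
  by exists ([:: b], 1) => //; split=> //= b'; rewrite inE => /eqP ->.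
have [z [zy [/= /(_ b (mem_head _ _)) zb _]]] := filter_ex (filterI F1 F2).
rewrite (_ : y - b.1 = (z - b.1) + (y - z)); last by rewrite [RHS]addrC addrA subrK.
apply: le_trans (ler_normD _ _) _; apply: lerD => //.
by move: zy; rewrite -ball_normE/= => /ltW.
Qed.

(** * Caratheodory reduction *)

Definition affinely_free {R : realType} {V : lmodType R} {I : finType}
    (P : pred I) (p : I -> V) : Prop :=
  forall a : I -> R, (forall i, ~~ P i -> a i = 0) -> \sum_i a i = 0 ->
    \sum_i a i *: p i = 0 -> forall i, a i = 0.

(** Induction on the size of the support: an affine relation on the support is subtracted from [t]
    until a weight vanishes. *)
Lemma caratheodory (R : realType) (V : lmodType R) (I : finType) (p : I -> V)
    (t : I -> R) :
  simplex t ->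
  exists s, [/\ simplex s, \sum_i s i *: p i = \sum_i t i *: p i,
    forall i, 0 < s i -> 0 < t i & affinely_free (fun i => 0 < s i) p].
Proof.
have [k] := ubnP #|[pred i | 0 < t i]|.
elim: k t => // k IH t tk st.
have [fr|] := pselect (affinely_free (fun i => 0 < t i) p); first by exists t; split.
move=> /existsNP[a] /not_implyP[a0] /not_implyP[a1] /not_implyP[ap] /existsNP[i0 /eqP ai0].
have t0 j : 0 <= t j by case: st.
have [i ai] : exists i, 0 < a i.
  apply/existsP; apply: contraT => /existsPn na; exfalso; move/negP: ai0; apply.
  rewrite -oppr_eq0; apply/eqP.
  have /psumr_eq0P : forall j, true -> 0 <= - a j.
    by move=> j _; rewrite oppr_ge0 leNgt na.
  by apply=> //; rewrite sumrN a1 oppr0.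
(* The least ratio [t i / a i] over [a i > 0] is the largest multiple of [a] that keeps all weights
   nonnegative. *)
case: (@arg_minP _ _ _ i (fun i => 0 < a i) (fun i => t i / a i) ai) => j aj jmin.
pose l := t j / a j.
have l0 : 0 <= l by rewrite divr_ge0 ?t0 ?ltW.
pose s i := t i - l * a i.
have sj : s j = 0 by rewrite /s divfK ?subrr ?gt_eqF.
have tj : 0 < t j.
  by rewrite lt_neqAle t0 andbT eq_sym; apply: contraTneq aj => tj; rewrite a0 ?tj ?ltxx.
have s_le i' : 0 < s i' -> 0 < t i'.
  rewrite /s; move: (t0 i'); rewrite le_eqVlt => /predU1P[ti|//].
  by rewrite (a0 i') -ti ?ltxx// mulr0 subrr ltxx.
have ss : simplex s.
  split=> [i'|]; last by rewrite sumrB -mulr_sumr a1 mulr0 subr0 st.2.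
  rewrite /s subr_ge0; have [ai'|ai'] := leP (a i') 0.
    by rewrite (le_trans _ (t0 i'))// mulr_ge0_le0.
  by rewrite -ler_pdivlMr//; exact: jmin.
have [|//|s' [ss' e' h' f']] := IH s.
  rewrite -ltnS; apply: leq_trans tk; rewrite ltnS; apply: proper_card.
  apply/properP; split; first by apply/fintype.subsetP => x; rewrite !inE; exact: s_le.
  by exists j; rewrite !inE// sj ltxx.
exists s'; split=> // [|x /h' /s_le//].
rewrite e' (_ : \sum_i s i *: p i = \sum_i t i *: p i - l *: \sum_i a i *: p i).
  by rewrite ap scaler0 subr0.
by rewrite scaler_sumr -sumrB; apply: eq_bigr => x _; rewrite /s scalerBl scalerA.
Qed.

(** * From (C) to (E) *)

Lemma card_le_lin_dim (R : realType) (V : lmodType R) (I : finType)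
    (A : pred I) (e : I -> V) :
  (forall c : I -> R, (forall i, ~~ A i -> c i = 0) ->
     \sum_i c i *: e i = 0 -> forall i, c i = 0) ->
  (#|A|%:R%:E <= lin_dim V)%E.
Proof.
move=> free; apply: ereal_sup_ubound; exists #|A| => //=.
exists (fun j => e (enum_val j)) => c c0 j.
have Aj : enum_val j \in A by exact: enum_valP.
pose d i := if i \in A then c (enum_rank_in Aj i) else 0.
have dE k : d (enum_val k) = c k by rewrite /d enum_valP enum_valK_in.
rewrite -dE; apply: free => [i /negPf Ai|]; first by rewrite /d unfold_in Ai.
rewrite -[RHS]c0 [LHS](bigID (mem A))/= addrC big1 ?add0r.
  by rewrite big_enum_val; apply: eq_bigr => k _; rewrite dE.
by move=> i /negPf Ai; rewrite /d Ai scale0r.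
Qed.

(** Condition (C), spelled so as to be convertible with its form in the theorem. *)
Definition hull_nonexpansive {R : realType} {Z Y : normedModType R} (X : set Z)
    (v : Z -> Y) : Prop :=
  forall k : nat, (0 < k)%N -> (k%:R%:E <= lin_dim Y)%E ->
    forall (x0 : Z) (x : 'I_k -> Z) (t : 'I_k -> R),
      X x0 -> (forall i, X (x i)) ->
      (forall i, 0 <= t i) -> \sum_(i < k) t i = 1 ->
      `|v x0 - \sum_(i < k) t i *: v (x i)|
        <= `|x0 - \sum_(i < k) t i *: x i|.

(** Only the indices of positive weight count against [lin_dim Y], whatever the size of [I]. *)
Lemma hull_nonexpansive_supp (R : realType) (Z Y : normedModType R) (X : set Z)
    (v : Z -> Y) (I : finType) (w : I -> R) (x0 : Z) (a : I -> Z) :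
  hull_nonexpansive X v -> X x0 -> (forall i, X (a i)) -> simplex w ->
  (#|[pred i | 0 < w i]%R|%:R%:E <= lin_dim Y)%E ->
  `|v x0 - \sum_i w i *: v (a i)| <= `|x0 - \sum_i w i *: a i|.
Proof.
move=> hC Xx0 Xa [w0 w1]; set A := [pred i | _] => Adim.
have sE (V : lmodType R) (F : I -> V) :
    \sum_i w i *: F i = \sum_(j < #|A|) w (enum_val j) *: F (enum_val j).
  rewrite (bigID (mem A))/= [X in _ + X]big1 ?addr0; first by rewrite big_enum_val.
  move=> i; rewrite inE/= lt_neqAle w0 andbT negbK => /eqP <-.
  by rewrite scale0r.
have e1 : \sum_(j < #|A|) w (enum_val j) = 1.
  rewrite -w1; have := sE R^o (fun=> 1).
  under eq_bigr do rewrite [_ *: _]mulr1.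
  by under [in RHS]eq_bigr do rewrite [_ *: _]mulr1.
rewrite !sE; apply: hC => //.
rewrite lt0n; apply/eqP => A0; move: e1; rewrite big1 => [/eqP|]; first by rewrite eq_sym oner_eq0.
by move=> j _; have := ltn_ord j; rewrite [X in (_ < X)%N]A0.
Qed.

Lemma finite_extension (R : realType) (Z Y : normedModType R)
    (BZ : Z -> Z -> R) (BY : Y -> Y -> R) (X : set Z) (v : Z -> Y)
    (x0 : Z) (rho : R) n (a : 'I_n -> Z) (b : 'I_n -> Y) :
  inner BZ -> inner BY -> hull_nonexpansive X v -> X x0 -> 0 <= rho ->
  (forall i, X (a i)) -> (forall i j, `|b i - b j| <= `|a i - a j|) ->
  (forall i, `|b i - v (a i)| <= rho) ->
  exists y, `|y - v x0| <= rho /\ forall i, `|y - b i| <= `|x0 - a i|.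
Proof.
move=> [hZ nZ] [hY nY] hC Xx0 rho0 Xa bLip bv.
(* Index [ord0] stands for the ball about [v x0], index [lift ord0 i] for the ball about [b i]; [r2]
   holds squared radii. *)
pose p i := oapp b (v x0) (unlift ord0 i).
pose r2 i := oapp (fun j => `|x0 - a j| ^+ 2) (rho ^+ 2) (unlift ord0 i).
have p0 : p ord0 = v x0 by rewrite /p unlift_none.
have pl i : p (lift ord0 i) = b i by rewrite /p liftK.
have r0 : r2 ord0 = rho ^+ 2 by rewrite /r2 unlift_none.
have rl i : r2 (lift ord0 i) = `|x0 - a i| ^+ 2 by rewrite /r2 liftK.
have [|x d|t] := @simplex_opt R Y BY n (fun i => BY (p i) (p i) - r2 i) p
    (fun y => `|y| ^+ 2) (fun y => 2 *: y) 1 (conj hY nY).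
- by move=> y; apply: cvgM; exact: norm_continuous.
- by rewrite !nY !(psdE hY) (psdC hY d x) le_eqVlt; apply/orP; left; apply/eqP; ring.
move=> /=; set m := \sum_i t i *: p i; set mu := \sum_i _ => -[st _ tle teq].
(* The optimal dual value; if it is at most 0, then [m] lies in every ball. *)
pose M := mu - BY m m.
have ple i : `|m - p i| ^+ 2 <= r2 i + M.
  have := tle i; rewrite nY /M !(psdE hY) (psdC hY (p i) m).
  by move: (r2 i) (BY _ _) (BY _ _) (BY _ _) => ? ? ? ?; lra.
have peq i : 0 < t i -> `|m - p i| ^+ 2 = r2 i + M.
  move=> /teq; rewrite nY /M !(psdE hY) (psdC hY (p i) m).
  by move: (r2 i) (BY _ _) (BY _ _) (BY _ _) => ? ? ? ?; lra.
have [M0|M0] := leP M 0.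
  exists m; split=> [|i].
    rewrite -(@ler_pXn2r _ 2) ?nnegrE//.
    by have := ple ord0; rewrite p0 r0; lra.
  rewrite -(@ler_pXn2r _ 2) ?nnegrE//.
  by have := ple (lift ord0 i); rewrite pl rl; lra.
exfalso.
have [s [ss sm s_t sfree]] := caratheodory p st.
rewrite -/m in sm.
have s0 i : 0 <= s i by case: ss.
set S := s ord0; pose T := \sum_(i < n) s (lift ord0 i).
have ST : S + T = 1 by rewrite -ss.2 big_ord_recl.
have mE : m = S *: v x0 + \sum_(i < n) s (lift ord0 i) *: b i.
  rewrite -sm big_ord_recl p0; congr (_ + _).
  by apply: eq_bigr => i _; rewrite pl.
have T0 : 0 < T.
  rewrite lt_neqAle sumr_ge0// andbT; apply/negP => /eqP T0.
  (* All the weight on [ord0] would force [m = v x0], and activity would read [0 = rho^2 + M]. *)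
  have S1 : S = 1 by lra.
  have := peq ord0 (s_t ord0 _); rewrite -/S S1 ltr01 => /(_ isT).
  have -> : m = v x0.
    rewrite mE S1 scale1r big1 ?addr0// => i _.
    move/esym/eqP: T0; rewrite psumr_eq0// => /allP/(_ i (mem_index_enum _)).
    by move=> /eqP ->; rewrite scale0r.
  by rewrite p0 r0 subrr normr0 expr0n/=; have := sqr_ge0 rho; lra.
pose w i := s (lift ord0 i) / T.
have sw : simplex w.
  by split=> [i|]; [rewrite divr_ge0// ltW|rewrite -mulr_suml divff ?gt_eqF].
have w1 := sw.2.
have w_s i : 0 < w i -> 0 < s (lift ord0 i) by rewrite pmulr_lgt0 ?invr_gt0.
pose ub := \sum_i w i *: b i; pose ab := \sum_i w i *: a i.
have mw : m = S *: v x0 + T *: ub.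
  rewrite mE scaler_sumr; congr (_ + _); apply: eq_bigr => i _.
  by rewrite scalerA mulrC divfK ?gt_eqF.
(* Average the equalities [peq] over [w]. Contraction of pairwise distances bounds the variance of
   the [b i] by that of the [a i], which leaves the distances of the means. *)
have key : `|ab - x0| ^+ 2 + M <= `|ub - m| ^+ 2.
  have e1 : \sum_i w i * BY (b i - m) (b i - m) =
            \sum_i w i * BZ (a i - x0) (a i - x0) + M.
    rewrite -[M]mul1r -w1 mulr_suml -big_split/=; apply: eq_bigr => i _.
    have [->|wi] := eqVneq (w i) 0; first by rewrite !mul0r addr0.
    rewrite -mulrDr; congr (_ * _).
    have wp : 0 < w i by rewrite lt_neqAle eq_sym wi sw.1.
    by rewrite -nY -nZ distrC -pl peq ?rl 1?distrC// s_t ?w_s.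
  rewrite (psd_variance hY _ _ w1) (psd_variance hZ _ _ w1) -/ub -/ab -nY -nZ in e1.
  have : \sum_i w i * BY (b i - ub) (b i - ub) <= \sum_i w i * BZ (a i - ab) (a i - ab).
    rewrite -(@ler_pM2l _ 2)// -!psd_variance_pairs//.
    apply: ler_sum => j _; apply: ler_wpM2l; first exact: sw.1.
    apply: ler_sum => i _; apply: ler_wpM2l; first exact: sw.1.
    by rewrite -nY -nZ ler_pXn2r ?nnegrE.
  by lra.
have eqS : `|ub - m| = S * `|ub - v x0|.
  rewrite (_ : S * _ = `|S *: (ub - v x0)|); last by rewrite normrZ ger0_norm ?s0.
  congr `|_|.
  rewrite mw scalerBr opprD addrCA addrC; congr (_ - _).
  by rewrite -[X in X - _]scale1r -ST scalerDl addrK.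
have [S0|S0] := eqVneq S 0.
  by move: key; rewrite eqS S0 mul0r expr0n/=; have := sqr_ge0 `|ab - x0|; lra.
have Sp : 0 < S by rewrite lt_neqAle eq_sym S0 s0.
have eqT : `|m - v x0| = T * `|ub - v x0|.
  rewrite (_ : T * _ = `|T *: (ub - v x0)|); last by rewrite normrZ gtr0_norm.
  congr `|_|.
  rewrite mw scalerBr addrAC addrC; congr (_ + _).
  by rewrite -[X in _ - X]scale1r -ST scalerDl opprD addrA subrr sub0r.
have hT := peq ord0 (s_t _ Sp).
rewrite p0 r0 eqT in hT; rewrite eqS in key.
have d0 := normr_ge0 (ub - v x0).
have lt1 : rho < T * `|ub - v x0|.
  rewrite -(@ltr_pXn2r _ 2) ?nnegrE ?mulr_ge0 ?(ltW T0)//; lra.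
have lt2 : `|ab - x0| < S * `|ub - v x0|.
  rewrite -(@ltr_pXn2r _ 2) ?nnegrE ?mulr_ge0//; lra.
have lt3 : rho + `|ab - x0| < `|ub - v x0|.
  by rewrite -[ltRHS]mul1r -ST mulrDl; lra.
have Cv : `|v x0 - \sum_i w i *: v (a i)| <= `|x0 - \sum_i w i *: a i|.
  apply: (hull_nonexpansive_supp hC) => //.
  apply: (@card_le_lin_dim _ _ _ _ (fun i => b i - v x0)) => c c0 cs i.
  (* A linear relation among the [b i - v x0] is an affine relation among the [p j]. It may charge
     [ord0] because [S > 0] puts [ord0] in the support. *)
  pose a' j := oapp c (- \sum_i c i) (unlift ord0 j).
  have al j : a' (lift ord0 j) = c j by rewrite /a' liftK.
  have a0 : a' ord0 = - \sum_i c i by rewrite /a' unlift_none.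
  rewrite -al; apply: sfree.
  - move=> j; case: (unliftP ord0 j) => [k ->|->]; last by rewrite -/S Sp.
    by rewrite al => sk; apply: c0; apply: contra sk => /w_s.
  - rewrite big_ord_recl a0 addrC; apply/eqP; rewrite subr_eq0; apply/eqP.
    by apply: eq_bigr => k _; exact: al.
  - rewrite big_ord_recl a0 p0.
    rewrite [X in _ + X](eq_bigr (fun k => c k *: b k)); last by move=> k _; rewrite al pl.
    rewrite -[RHS]cs; under [RHS]eq_bigr do rewrite scalerBr.
    by rewrite sumrB -scaler_suml addrC scaleNr.
have : `|ub - v x0| <= `|ub - \sum_i w i *: v (a i)| + `|\sum_i w i *: v (a i) - v x0|.
  exact: ler_distD.
have : `|ub - \sum_i w i *: v (a i)| <= rho.
  rewrite -sumrB; under eq_bigr do rewrite -scalerBr.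
  apply: le_trans (ler_norm_sum _ _ _) _.
  rewrite -[leRHS]mul1r -w1 mulr_suml; apply: ler_sum => i _.
  by rewrite normrZ ger0_norm ?sw.1// ler_wpM2l ?sw.1.
move: Cv; rewrite -/ab distrC (distrC x0); lra.
Qed.

(** * From finite to arbitrary sets: intersections of balls and Zorn's lemma *)

Lemma lipschitz1P (R : realType) (Z Y : normedModType R) (A : set Z) (u : Z -> Y) :
  (1 : R).-lipschitz_A u <-> forall x y, A x -> A y -> `|u x - u y| <= `|x - y|.
Proof.
split=> [h x y Ax Ay|h [x y] [/= Ax Ay]]; last by rewrite mul1r; exact: h.
by have := h (x, y) (conj Ax Ay); rewrite /= mul1r.
Qed.

(** Partial maps are encoded as graphs, ordered by inclusion. The first clause forces
    single-valuedness, as equal first components have distance 0. *)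
Definition nonexpansive_graph {R : realType} {Z Y : normedModType R} (X : set Z)
    (v : Z -> Y) (rho : R) (G : set (Z * Y)) : Prop :=
  (forall g g', G g -> G g' -> `|g.2 - g'.2| <= `|g.1 - g'.1|) /\
  (forall g, G g -> X g.1 /\ `|g.2 - v g.1| <= rho).

Lemma one_point_extension (R : realType) (Z Y : completeNormedModType R)
    (X : set Z) (v : Z -> Y) (rho : R) (G : set (Z * Y)) (x0 : Z) :
  hilbert Z -> hilbert Y -> hull_nonexpansive X v -> 0 <= rho ->
  nonexpansive_graph X v rho G -> X x0 ->
  exists y, `|y - v x0| <= rho /\ forall g, G g -> `|y - g.2| <= `|x0 - g.1|.
Proof.
move=> /hilbert_inner[BZ hZ] /hilbert_inner[BY hY] hC rho0 [Glip GX] Xx0.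
pose S := [set b : Y * R | b = (v x0, rho) \/
                           exists2 g, G g & b = (g.2, `|x0 - g.1|)].
have [|s sS|y hy] := @balls_intersect R Y BY S (v x0) rho hY; first by left.
  (* Pull the finite list of balls back to the graph points that produce them. *)
  have [gs gsG sgs] : exists2 gs : seq (Z * Y), (forall g, g \in gs -> G g) &
      forall b, b \in s -> b = (v x0, rho) \/
                           exists2 g, g \in gs & b = (g.2, `|x0 - g.1|).
    elim: s sS => [|b s IH] sS; first by exists [::].
    have [|gs gsG sgs] := IH; first by move=> b' bs; apply: sS; rewrite inE bs orbT.
    have [bE|[g Gg bE]] := sS b (mem_head _ _).
      by exists gs => // b'; rewrite inE => /predU1P[->|/sgs//]; left.
    exists (g :: gs) => [g'|b']; rewrite inE => /predU1P[->//|]; first exact: gsG.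
      by right; exists g => //; exact: mem_head.
    move=> /sgs[->|[g' g'gs ->]]; first by left.
    by right; exists g' => //; rewrite inE g'gs orbT.
  pose e i := tnth (in_tuple gs) i.
  have eG i : G (e i) by apply: gsG; exact: mem_tnth.
  have [|||y [yv ye]] := @finite_extension R Z Y BZ BY X v x0 rho (size gs)
    (fun i => (e i).1) (fun i => (e i).2) hZ hY hC Xx0 rho0.
  - by move=> i; case: (GX _ (eG i)).
  - by move=> i j; exact: Glip.
  - by move=> i; case: (GX _ (eG i)).
  exists y => b /sgs[->//|[g ggs ->]] /=.
  by have /tnthP[i ->] : g \in in_tuple gs by []; exact: ye.
exists y; split; first by apply: (hy (v x0, rho)); left.
by move=> g Gg; apply: (hy (g.2, `|x0 - g.1|)); right; exists g.
Qed.

Lemma full_extension (R : realType) (Z Y : completeNormedModType R)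
    (X A : set Z) (v u : Z -> Y) (rho : R) :
  hilbert Z -> hilbert Y -> hull_nonexpansive X v -> A `<=` X -> 0 <= rho ->
  (1 : R).-lipschitz_A u -> (forall x, A x -> `|u x - v x| <= rho) ->
  exists ut : Z -> Y, [/\ (1 : R).-lipschitz_X ut,
    (forall x, A x -> ut x = u x) & (forall x, X x -> `|ut x - v x| <= rho)].
Proof.
move=> hZ hY hC AX rho0 /lipschitz1P uLip uv.
pose G0 := [set g : Z * Y | A g.1 /\ g.2 = u g.1].
(* Adjoining [G0] makes [P] hold for the union of the empty chain. *)
pose P (G : set (Z * Y)) := nonexpansive_graph X v rho (G `|` G0).
have P0 : nonexpansive_graph X v rho G0.
  split=> [g g' [Ag ->] [Ag' ->]|g [Ag ->]]; first exact: uLip.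
  by split; [exact: AX|exact: uv].
have [F FP Ftot|G [[Glip GX] Gmax]] := @Zorn_bigcup _ P.
  split.
    move=> g g' [[G1 F1 g1]|g0] [[G2 F2 g2]|g0'].
    - have [G12|G21] := Ftot _ _ F1 F2.
        by apply: (FP _ F2).1; left => //; exact: G12.
      by apply: (FP _ F1).1; left => //; exact: G21.
    - by apply: (FP _ F1).1; [left|right].
    - by apply: (FP _ F2).1; [right|left].
    - exact: P0.1.
  by move=> g [[G1 F1 g1]|g0]; [apply: (FP _ F1).2; left|exact: P0.2].
have total x : X x -> exists y, (G `|` G0) (x, y).
  move=> Xx; apply: contrapT => nG.
  have [y [yv yG]] := one_point_extension hZ hY hC rho0 (conj Glip GX) Xx.
  apply: (Gmax (G `|` [set (x, y)])).
    split; first by move=> g Gg; left.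
    by move=> /(_ (x, y) (or_intror erefl)) Gxy; apply: nG; exists y; left.
  have sub g : (G `|` [set (x, y)] `|` G0) g -> (G `|` G0) g \/ g = (x, y).
    by move=> [[]|]; [left; left|right|left; right].
  split=> [g g' /sub[Gg|->] /sub[Gg'|->]|g /sub[/GX//|->//]].
  - exact: Glip.
  - by rewrite distrC [leRHS]distrC; exact: yG.
  - exact: yG.
  - by rewrite !subrr !normr0.
have [ut utG] : exists ut : Z -> Y, forall x, X x -> (G `|` G0) (x, ut x).
  have h x : exists y, X x -> (G `|` G0) (x, y).
    by have [/total[y]|nX] := pselect (X x); [exists y|exists 0].
  by exists (fun x => projT1 (cid (h x))) => x; exact: projT2 (cid (h x)).
exists ut; split.
- by apply/lipschitz1P => x y Xx Xy; exact: (Glip (x, ut x) (y, ut y) (utG _ Xx) (utG _ Xy)).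
- move=> x Ax; apply/eqP; rewrite -subr_eq0 -normr_le0.
  have /= := Glip (x, ut x) (x, u x) (utG _ (AX _ Ax)) (or_intror (conj Ax erefl)).
  by rewrite subrr normr0.
- by move=> x Xx; case: (GX _ (utG _ Xx)).
Qed.

(** * From (E) to (C) *)

(** The matrix of products has more rows than columns, hence a nonzero left kernel vector; its
    entries are the coefficients of a vector orthogonal to [s]. *)
Lemma exists_unit_orthogonal (R : realType) (Y : normedModType R)
    (BY : Y -> Y -> R) k (e : 'I_k -> Y) (s : seq Y) :
  inner BY -> lin_indep e -> (size s < k)%N ->
  exists y, BY y y = 1 /\ forall z, z \in s -> BY y z = 0.
Proof.
move=> [hY nY] free sk.
pose M := \matrix_(i < k, j < size s) BY (e i) (tnth (in_tuple s) j).
have /rowV0Pn[a /sub_kermxP aM a0] : kermx M != 0.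
  rewrite kermx_eq0 /row_free neq_ltn; apply/orP; left.
  exact: leq_ltn_trans (rank_leq_col M) sk.
pose y := \sum_i a ord0 i *: e i.
have y0 : BY y y != 0.
  rewrite -nY sqrf_eq0 normr_eq0; apply: contra a0 => /eqP /free a0.
  by apply/eqP/rowP => i; rewrite mxE a0.
have yp : 0 < BY y y by rewrite lt_neqAle eq_sym y0 psd_ge0.
exists ((Num.sqrt (BY y y))^-1 *: y); split.
  by rewrite !(psdE hY) mulrA -expr2 exprVn sqr_sqrtr ?(ltW yp)// mulVf.
move=> z zs; have /tnthP[j ->] : z \in in_tuple s by [].
rewrite (psdZl hY).
move/rowP: aM => /(_ j); rewrite !mxE => aj.
rewrite [X in _ * X](_ : _ = 0) ?mulr0//; apply: etrans aj.
by rewrite (psd_suml hY); apply: eq_bigr => i _; rewrite !mxE (psdZl hY).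
Qed.

Definition orthonormal_seq {R : realType} {Y : lmodType R} (BY : Y -> Y -> R)
    (es : seq Y) : Prop :=
  (forall e, e \in es -> BY e e = 1) /\ pairwise (fun x y => BY x y == 0) es.

Lemma exists_orthonormal (R : realType) (Y : normedModType R)
    (BY : Y -> Y -> R) (e : Y) n :
  inner BY -> BY e e = 1 -> (n.+1%:R%:E <= lin_dim Y)%E ->
  exists es, size es = n /\ orthonormal_seq BY (e :: es).
Proof.
move=> hY e1 nY.
(* A supremum of at least [n.+1] provides some free family with more than [n] members, not one of
   prescribed size. *)
have [k [b [bfree nk]]] : exists k (b : 'I_k -> Y), lin_indep b /\ (n < k)%N.
  apply: contrapT => no; suff : (lin_dim Y <= n%:R%:E)%E.
    by move=> /(le_trans nY); rewrite lee_fin ler_nat ltnn.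
  apply: ge_ereal_sup => _ [k [b bfree] <-]; rewrite lee_fin ler_nat leqNgt.
  by apply/negP => nk; apply: no; exists k, b.
elim: n {nY} nk => [|n IH] nk; first by exists [::]; split=> //; split=> // x; rewrite inE => /eqP ->.
have [es [sz [es1 esp]]] := IH (ltnW nk).
have [|y [y1 yo]] := exists_unit_orthogonal (s := e :: es) hY bfree; first by rewrite /= sz.
exists (y :: es); split; first by rewrite /= sz.
split=> [z|].
  by rewrite !inE => /or3P[/eqP ->|/eqP ->|zs]//; apply: es1; rewrite inE zs orbT.
move: esp; rewrite /= => /andP[-> ->]; rewrite !andbT; apply/andP; split.
  by apply/eqP; rewrite (psdC hY.1); apply: yo; exact: mem_head.
by apply/allP => z zs; apply/eqP; apply: yo; rewrite inE zs orbT.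
Qed.

(* Peel off one vector [z] of [zs] at a time, replacing [B] by its Schur
   complement [B x y - B z x * B z y / B z z]; when [B z z = 0] the numerator
   vanishes too, so the convention [a / 0 = 0] is harmless. *)
Lemma psd_embedding (R : realType) (V Y : lmodType R) (B : V -> V -> R)
    (BY : Y -> Y -> R) (zs : seq V) (es : seq Y) :
  psd B -> psd BY -> size es = size zs -> orthonormal_seq BY es ->
  exists W : V -> Y,
  [/\ forall x, BY (W x) (W x) <= B x x,
      forall x y, x \in zs -> BY (W x) (W y) = B x y &
      forall y, (forall e, e \in es -> BY e y = 0) -> forall x, BY (W x) y = 0].
Proof.
move=> hB hY; elim: zs es B hB => [|z zs IH] [|e es]// B hB.
  move=> _ _; exists (fun=> 0); split=> //.
    by move=> x; rewrite (psd0l hY) psd_ge0.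
  by move=> y _ x; rewrite (psd0l hY).
move=> [sz] [es1 /= /andP[/allP eo esp]].
pose B' x y := B x y - B z x * B z y / B z z.
have hB' : psd B'.
  split.
  - by move=> x y; rewrite /B' (psdC hB x) mulrC [B z y * _]mulrC mulrC.
  - by move=> a x y w; rewrite /B' !(psdE hB); ring.
  - move=> x; rewrite /B' subr_ge0 -expr2.
    have [z0|z0] := eqVneq (B z z) 0; first by rewrite z0 invr0 mulr0 psd_ge0.
    by rewrite ler_pdivrMr ?lt_neqAle 1?eq_sym ?z0 ?psd_ge0// mulrC psdCS.
have [W [Wle WB Wo]] : exists W : V -> Y,
  [/\ forall x, BY (W x) (W x) <= B' x x,
      forall x y, x \in zs -> BY (W x) (W y) = B' x y &
      forall y, (forall e, e \in es -> BY e y = 0) -> forall x, BY (W x) y = 0].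
  by apply: IH => //; split=> // x xs; apply: es1; rewrite inE xs orbT.
have We x : BY (W x) e = 0 by apply: Wo => e' /eo /eqP; rewrite psdC.
pose c x := B z x / Num.sqrt (B z z).
have ce x y : BY (c x *: e + W x) (c y *: e + W y) =
              B z x * B z y / B z z + BY (W x) (W y).
  rewrite !(psdE hY) (psdC hY e (W y)) !We es1 ?mem_head//.
  rewrite [LHS](_ : _ = c x * c y + BY (W x) (W y)); last by ring.
  congr (_ + _).
  by rewrite /c mulrACA -invfM -expr2 sqr_sqrtr// psd_ge0.
exists (fun x => c x *: e + W x); split.
- by move=> x; rewrite ce -lerBrDl; exact: Wle.
- move=> x y; rewrite inE ce => /predU1P[->|xs]; last by rewrite WB// /B' addrC subrK.
  have zz w : B z z * B z w / B z z = B z w.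
    have [z0|z0] := eqVneq (B z z) 0; last by rewrite mulrAC divff// mul1r.
    by rewrite z0 !mul0r (psd_eq0 hB _ z0).
  (* The Schur complement vanishes at [z], so [W z] is null and only the [e]-component
     contributes. *)
  rewrite zz (psd_eq0 hY) ?addr0//; apply/eqP; rewrite eq_le psd_ge0// andbT.
  by apply: le_trans (Wle z) _; rewrite /B' zz subrr.
- move=> y yo x; rewrite !(psdE hY) yo ?mem_head// mulr0 add0r.
  by apply: Wo => e' ee; apply: yo; rewrite inE ee orbT.
Qed.

(** The gap to the tangent at [a] is a square divided by [2 * Num.sqrt a]. *)
Lemma sqrt_le_tangent (R : rcfType) (a b : R) :
  0 < a -> 0 <= b -> Num.sqrt b <= Num.sqrt a + (b - a) / (2 * Num.sqrt a).
Proof.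
move=> a0 b0; have sa : 0 < Num.sqrt a by rewrite sqrtr_gt0.
rewrite -[X in (X - _) / _](sqr_sqrtr b0) -[X in (_ - X) / _](sqr_sqrtr (ltW a0)).
rewrite -subr_ge0 (_ : _ - _ = (Num.sqrt b - Num.sqrt a) ^+ 2 / (2 * Num.sqrt a)); last by field; rewrite gt_eqF.
by rewrite divr_ge0 ?sqr_ge0// mulr_ge0// ltW.
Qed.

(* First-order optimality for the concave function
   [s |-> sum s f - sqrt (eps + |sum s x - x0|^2)]; the positive [eps] makes it
   differentiable. *)
Lemma supporting_slope (R : realType) (Z : normedModType R) (BZ : Z -> Z -> R)
    n (x : 'I_n.+1 -> Z) (x0 : Z) (f : 'I_n.+1 -> R) (f0 : R) (t : 'I_n.+1 -> R) :
  inner BZ -> simplex t ->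
  f0 + `|x0 - \sum_i t i *: x i| < \sum_i t i * f i ->
  exists s p, let m := \sum_i s i *: x i in
  [/\ simplex s, BZ p p <= 1, f0 + `|x0 - m| < \sum_i s i * f i &
      forall i, 0 < s i -> f i - BZ p (x i - m) = \sum_i s i * f i].
Proof.
move=> hZ st; set xt := \sum_i t i *: x i; set N := \sum_i _ => lt.
pose N0 := N - f0.
have N00 : `|xt - x0| < N0 by rewrite distrC /N0; lra.
(* This makes [eps + |xt - x0|^2] the midpoint of [|xt - x0|^2] and [N0^2], so the strict inequality
   survives smoothing. *)
pose eps := (N0 ^+ 2 - `|xt - x0| ^+ 2) / 2.
have Np : 0 < N0 by apply: le_lt_trans N00.
have sq_lt : `|xt - x0| ^+ 2 < N0 ^+ 2 by rewrite ltr_pXn2r ?nnegrE// ltW.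
have eps0 : 0 < eps by rewrite /eps; lra.
pose q z := eps + `|z - x0| ^+ 2.
have q0 z : 0 < q z by rewrite ltr_wpDr ?sqr_ge0.
have epsq z : eps <= q z by rewrite lerDl sqr_ge0.
pose h z := Num.sqrt (q z).
have h0 z : 0 < h z by rewrite sqrtr_gt0.
have hn z : `|z - x0| <= h z.
  by rewrite -(ger0_norm (normr_ge0 (z - x0))) -sqrtr_sqr ler_sqrt ?lerDr ?ltW.
pose g z := (h z)^-1 *: (z - x0).
have cq : continuous q.
  move=> z; apply: cvgD; first exact: cvg_cst.
  have c1 : `|w - x0| @[w --> z] --> `|z - x0|.
    by apply: cvg_norm; apply: cvgB; [exact: cvg_id|exact: cvg_cst].
  exact: (cvgM c1 c1).
have [||s] := @simplex_opt R Z BZ n f x h g ((2 * Num.sqrt eps)^-1) hZ.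
- by move=> z; apply: continuous_comp; [exact: cq|exact: sqrt_continuous].
- move=> z d; have := sqrt_le_tangent (q0 z) (ltW (q0 (z + d))); rewrite -/(h _) -/(h _).
  move/le_trans; apply; rewrite -[leRHS]addrA lerD2l.
  have -> : q (z + d) - q z = 2 * BZ (z - x0) d + BZ d d.
    rewrite /q !hZ.2 (_ : z + d - x0 = (z - x0) + d); last by rewrite addrAC.
    by move: (z - x0) => w; rewrite !(psdE hZ.1) (psdC hZ.1 d w); ring.
  rewrite mulrDl /g (psdZl hZ.1); apply: lerD.
    by rewrite le_eqVlt; apply/orP; left; apply/eqP; field; rewrite gt_eqF.
  rewrite mulrC ler_wpM2r ?(psd_ge0 hZ.1)// lef_pV2 ?posrE ?mulr_gt0 ?sqrtr_gt0//.
  by rewrite ler_pM2l// ler_sqrt// ltW.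
move=> /=; set m := \sum_i s i *: x i => -[ss smax _ sact].
(* The gradient at [m] has norm [|m - x0| / h m], which [hn] bounds by 1. *)
exists s, (g m); split=> //.
  rewrite /g !(psdZl hZ.1) !(psdZr hZ.1) -hZ.2 mulrA -invfM -expr2.
  by rewrite mulrC ler_pdivrMr ?exprn_gt0// mul1r ler_pXn2r ?nnegrE// ltW.
have := smax t st; rewrite -/xt -/N.
have : h xt < N0.
  rewrite -[ltRHS](ger0_norm (ltW Np)) -sqrtr_sqr ltr_sqrt ?exprn_gt0//.
  by rewrite /q /eps; lra.
by have := hn m; rewrite distrC /N0; lra.
Qed.

Lemma inner_le_norm (R : realType) (Y : normedModType R) (BY : Y -> Y -> R) (e y : Y) :
  inner BY -> BY e e = 1 -> BY y e <= `|y|.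
Proof.
move=> [hY nY] e1; apply: le_trans (ler_norm _) _.
rewrite -(@ler_pXn2r _ 2) ?nnegrE// real_normK ?num_real// nY.
by have := psdCS hY y e; rewrite e1 mulr1.
Qed.

Lemma extension_hull_nonexpansive (R : realType) (Z Y : completeNormedModType R)
    (X : set Z) (v : Z -> Y) :
  hilbert Z -> hilbert Y ->
  (forall (A : set Z) (rho : R) (u : Z -> Y),
      A `<=` X -> 0 <= rho -> (1 : R).-lipschitz_A u ->
      (forall x, A x -> `|u x - v x| <= rho) ->
      exists ut : Z -> Y, [/\ (1 : R).-lipschitz_X ut,
         (forall x, A x -> ut x = u x) & (forall x, X x -> `|ut x - v x| <= rho)]) ->
  hull_nonexpansive X v.
Proof.
move=> /hilbert_inner[BZ hZ] /hilbert_inner[BY hY] hE [//|k] _ kY x0 x t Xx0 Xx t0 t1.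
have [hZ1 nZ] := hZ; have [hY1 nY] := hY.
rewrite leNgt; apply/negP; set vt := \sum_i _ *: v _; set N := `|v x0 - _| => ltN.
have Np : 0 < N by apply: le_lt_trans ltN.
pose e := N^-1 *: (vt - v x0).
have e1 : BY e e = 1.
  by rewrite -nY normrZ ger0_norm ?invr_ge0 ?ltW// distrC mulVf ?expr1n// gt_eqF.
have eN : vt - v x0 = N *: e by rewrite scalerA divff ?scale1r// gt_eqF.
clearbody e.
pose f z := BY (v z) e.
have [s [p]] : exists s p, let m := \sum_i s i *: x i in
  [/\ simplex s, BZ p p <= 1, f x0 + `|x0 - m| < \sum_i s i * f (x i) &
      forall i, 0 < s i -> f (x i) - BZ p (x i - m) = \sum_i s i * f (x i)].
  apply: (supporting_slope (t := t)) => //.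
  have -> : \sum_i t i * f (x i) = f x0 + N.
    transitivity (BY vt e).
      by rewrite (psd_suml hY1); apply: eq_bigr => i _; rewrite (psdZl hY1).
    rewrite -[vt](subrK (v x0)) (psdDl hY1) addrC; congr (_ + _).
    by rewrite eN (psdZl hY1) e1 mulr1.
  by rewrite ltrD2l.
move=> /=; set m := \sum_i s i *: x i; set F := \sum_i _ => -[ss p1 ltF act].
(* Half of the strict gap: one [eta] is spent to keep [u] within [rho] of [v], the other yields the
   final contradiction. *)
pose eta := (F - f x0 - `|x0 - m|) / 2.
have etaE : 2 * eta = F - f x0 - `|x0 - m| by rewrite /eta; field.
have eta0 : 0 < eta by lra.
have [j0 sj0] : exists j0, 0 < s j0.
  apply: contrapT => /forallNP no; have := ss.2; rewrite big1 => [/esym/eqP|i _].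
    by rewrite oner_eq0.
  by apply/eqP; rewrite eq_le ss.1 andbT leNgt; apply/negP/no.
pose B x y := BZ x y - BZ p x * BZ p y.
have hB : psd B.
  split.
  - by move=> y z; rewrite /B (psdC hZ1 y) [BZ p y * _]mulrC.
  - by move=> a y z w; rewrite /B !(psdE hZ1); ring.
  - move=> y; rewrite /B subr_ge0 -expr2; apply: le_trans (psdCS hZ1 p y) _.
    by rewrite ler_piMl// psd_ge0.
have [es [szes [es1 /= /andP[/allP eo esp]]]] := exists_orthonormal hY e1 kY.
(* The family has [k.+1] points, so omitting the zero difference at [j0] leaves [k] vectors,
   matching the [k] directions orthogonal to [e]. The omitted one is recovered in [WBx] from
   [Wle 0]. *)
pose zs := [seq x (lift j0 i) - x j0 | i <- enum 'I_k].
have [||W [Wle WB Wo]] := @psd_embedding R Z Y B BY zs es hB hY1.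
- by rewrite szes size_map size_enum_ord.
- by split=> // y ys; apply: es1; rewrite inE ys orbT.
have We y : BY (W y) e = 0.
  by apply: Wo => z /eo /eqP; rewrite (psdC hY1).
have WBx i y : BY (W (x i - x j0)) (W y) = B (x i - x j0) y.
  case: (unliftP j0 i) => [j ->|->]; first by apply: WB; apply: map_f; exact: mem_enum.
  rewrite subrr (psd0l hB); apply: (psd_eq0 hY1); apply/eqP.
  by rewrite eq_le psd_ge0// andbT (le_trans (Wle 0))// (psd0l hB).
have expand (V : lmodType R) (C : V -> V -> R) a b : psd C ->
    C (a - b) (a - b) = C a a - C a b - C b a + C b b.
  by move=> hC; rewrite !(psdE hC); ring.
have Wiso i j : BY (W (x i - x j0) - W (x j - x j0)) (W (x i - x j0) - W (x j - x j0)) =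
    B (x i - x j) (x i - x j).
  rewrite [in RHS](_ : x i - x j = (x i - x j0) - (x j - x j0)).
    by rewrite (expand _ _ _ _ hY1) !WBx (expand _ _ (x i - x j0) (x j - x j0) hB).
  by rewrite opprB addrA subrK.
(* [rho] is chosen so that [(rho - eta)^2 + |D (x i)|^2 <= rho^2], where [D] is
   the component of [u - v] orthogonal to [e]. *)
pose D z := (f z - f x0) *: e + W (z - x j0) - (v z - v x0).
have De z : BY (D z) e = 0.
  by rewrite /D !(psdE hY1) We e1 /f; ring.
pose K := \sum_i BY (D (x i)) (D (x i)).
have K0 : 0 <= K by apply: sumr_ge0 => i _; exact: psd_ge0.
pose rho := (eta ^+ 2 + K) / (2 * eta).
have rhoE : 2 * rho * eta = eta ^+ 2 + K by rewrite /rho; field; rewrite gt_eqF.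
have rho0 : 0 <= rho by rewrite divr_ge0 ?addr_ge0 ?sqr_ge0// mulr_ge0 ?ltW.
pose u z := v x0 + ((rho - eta + (f z - f x0)) *: e + W (z - x j0)).
have uiso i j : 0 < s i -> 0 < s j -> BY (u (x i) - u (x j)) (u (x i) - u (x j)) =
    BZ (x i - x j) (x i - x j).
  move=> si sj; set w := W (x i - x j0) - W (x j - x j0).
  have -> : u (x i) - u (x j) = (f (x i) - f (x j)) *: e + w.
    rewrite /u [LHS](_ : _ = (rho - eta + (f (x i) - f x0)) *: e -
      (rho - eta + (f (x j) - f x0)) *: e + w).
      by rewrite -scalerBl; congr (_ *: _ + _); ring.
    rewrite /w; move: (W _) (W _) (_ *: e) (_ *: e) (v x0) => a b c d z.
    by rewrite opprD addrACA subrr add0r opprD addrACA.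
  have we : BY w e = 0 by rewrite !(psdE hY1) !We subrr.
  (* On active points [f] has slope [p], so the [e]-component restores the square that [B] removes
     from [BZ]. *)
  have -> : f (x i) - f (x j) = BZ p (x i - x j).
    by have := act i si; have := act j sj; rewrite !(psdE hZ1); lra.
  have ww : BY w w = B (x i - x j) (x i - x j) by exact: Wiso.
  move: ww we; rewrite /B; move: w (x i - x j) => w d ww we.
  by rewrite !(psdE hY1) (psdC hY1 e w) we e1 ww; ring.
pose A := [set z | exists2 i, 0 < s i & z = x i].
have [||||ut [/lipschitz1P utLip utu utv]] := hE A rho u.
- by move=> z [i _ ->].
- exact: rho0.
- apply/lipschitz1P => z z' [i si ->] [j sj ->].
  by rewrite -(@ler_pXn2r _ 2) ?nnegrE// nY nZ uiso.
- move=> z [i si ->].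
  rewrite -(@ler_pXn2r _ 2) ?nnegrE// nY.
  have -> : u (x i) - v (x i) = (rho - eta) *: e + D (x i).
    rewrite /u /D scalerDl opprB !addrA; congr (_ - _).
    by rewrite -!addrA addrC -!addrA.
  have : BY (D (x i)) (D (x i)) <= K.
    by rewrite /K (bigD1 i)//= lerDl; apply: sumr_ge0 => j _; exact: psd_ge0.
  have := De (x i); move: (D (x i)) => w we.
  by rewrite !(psdE hY1) (psdC hY1 e w) we e1; nra.
have yv := utv x0 Xx0; set y := ut x0 in yv.
have yu i : 0 < s i -> `|u (x i) - y| <= `|x i - x0|.
  by move=> si; rewrite -utu; [exact: utLip|exists i].
pose ub := \sum_i s i *: u (x i).
have s1 := ss.2.
have s_cond i : s i = 0 \/ 0 < s i.
  by have := ss.1 i; rewrite le_eqVlt => /predU1P[<-|]; [left|right].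
(* The isometry makes the variances of the [u (x i)] and the [x i] equal, so contraction towards [y]
   passes to the means. *)
have uy : `|ub - y| <= `|m - x0|.
  have : \sum_i s i * BY (u (x i) - y) (u (x i) - y) <=
         \sum_i s i * BZ (x i - x0) (x i - x0).
    apply: ler_sum => i _; have [->|si] := s_cond i; first by rewrite !mul0r.
    by rewrite ler_pM2l// -nY -nZ ler_pXn2r ?nnegrE// yu.
  have : 2 * \sum_i s i * BY (u (x i) - ub) (u (x i) - ub) =
         2 * \sum_i s i * BZ (x i - m) (x i - m).
    rewrite -!psd_variance_pairs//; apply: eq_bigr => j _.
    have [->|sj] := s_cond j; first by rewrite !mul0r.
    congr (_ * _); apply: eq_bigr => i _.
    by have [->|si] := s_cond i; rewrite ?mul0r// uiso.
  rewrite (psd_variance hY1 _ y s1) (psd_variance hZ1 _ x0 s1) -/ub -/m -nY -nZ.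
  by rewrite -(@ler_pXn2r _ 2 _ `|ub - y|) ?nnegrE//; lra.
have ube : BY (ub - v x0) e = rho - eta + F - f x0.
  have -> : ub - v x0 = \sum_i s i *: (u (x i) - v x0).
    by under eq_bigr do rewrite scalerBr; rewrite sumrB -scaler_suml s1 scale1r.
  rewrite (psd_suml hY1).
  have term i : BY (s i *: (u (x i) - v x0)) e = (rho - eta - f x0) * s i + s i * f (x i).
    by rewrite /u (addrC (v x0)) addrK !(psdE hY1) We e1; ring.
  by under eq_bigr do rewrite term; rewrite big_split/= -mulr_sumr s1 -/F; ring.
have split : BY (ub - y) e + BY (y - v x0) e = rho - eta + F - f x0.
  by rewrite -ube -(psdDl hY1) addrA subrK.
have := inner_le_norm (ub - y) hY e1; have := inner_le_norm (y - v x0) hY e1.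
by move: uy; rewrite (distrC m); lra.
Qed.

Unset Implicit Arguments.

Theorem theorem1p1 (R : realType) (Z Y : completeNormedModType R)
    (hZ : hilbert Z) (hY : hilbert Y) (X : set Z) (v : Z -> Y) :
  (forall (A : set Z) (rho : R) (u : Z -> Y),
      A `<=` X -> 0 <= rho ->
      (1 : R).-lipschitz_A u ->
      (forall x, A x -> `|u x - v x| <= rho) ->
      exists ut : Z -> Y,
        [/\ (1 : R).-lipschitz_X ut,
            (forall x, A x -> ut x = u x) &
            (forall x, X x -> `|ut x - v x| <= rho)])
  <->
  (forall k : nat, (0 < k)%N -> (k%:R%:E <= lin_dim Y)%E ->
      forall (x0 : Z) (x : 'I_k -> Z) (t : 'I_k -> R),
        X x0 -> (forall i, X (x i)) ->
        (forall i, 0 <= t i) -> \sum_(i < k) t i = 1 ->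
        `|v x0 - \sum_(i < k) t i *: v (x i)|
          <= `|x0 - \sum_(i < k) t i *: x i|).
Proof.
split; first exact: extension_hull_nonexpansive.
by move=> hC A rho u; exact: full_extension.
Qed.
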